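(* Let $\lambda_1,\lambda_2\in\mathbb C^*$ and $\alpha_1,\alpha_2\in\mathbb C$. Then $\Omega'(\lambda_1,\lambda_2,\alpha_1,\alpha_2)$ is the unique irreducible $\tilde S_2$-submodule of $\Omega(\lambda_1,\lambda_2,\alpha_1,\alpha_2)$, and the quotient $\Omega(\lambda_1,\lambda_2,\alpha_1,\alpha_2)/\Omega'(\lambda_1,\lambda_2,\alpha_1,\alpha_2)\cong\mathbb C$ is one-dimensional.
   Context: All vector spaces and algebras are over $\mathbb C$; $\mathbb C^*=\mathbb C\setminus\{0\}$. Let $\mathcal A_2=\mathbb C[t_1^{\pm1},t_2^{\pm1}]$, $\partial_i=t_i\frac{\partial}{\partial t_i}$, $t^r=t_1^{r_1}t_2^{r_2}$ for $r=(r_1,r_2)\in\mathbb Z^2$. The Witt algebra is $\mathcal W_2=\mathcal A_2\partial_1\oplus\mathcal A_2\partial_2$ with bracket $[t^r\partial_i,t^s\partial_j]=s_it^{r+s}\partial_j-r_jt^{r+s}\partial_i$. The Lie algebra $\tilde S_2$ is its subalgebra $\mathrm{Span}_{\mathbb C}\{\partial_1,\partial_2,\ r_2t^r\partial_1-r_1t^r\partial_2 : r\in\mathbb Z^2\}$. The $\tilde S_2$-module $\Omega(\lambda_1,\lambda_2,\alpha_1,\alpha_2)$ is the vector space $\mathbb C[h_1,h_2]$ on which $\partial_i$ acts as multiplication by $h_i$ ($i=1,2$) and $$(r_2t^r\partial_1-r_1t^r\partial_2)\cdot f(h_1,h_2)=\lambda_1^{r_1}\lambda_2^{r_2}\bigl(r_2(h_1+\alpha_1)-r_1(h_2+\alpha_2)\bigr)f(h_1-r_1,h_2-r_2).$$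 $\Omega'(\lambda_1,\lambda_2,\alpha_1,\alpha_2)=\langle h_1+\alpha_1,h_2+\alpha_2\rangle$ is the ideal of the polynomial algebra $\mathbb C[h_1,h_2]$ generated by $h_1+\alpha_1$ and $h_2+\alpha_2$; it is an $\tilde S_2$-submodule. *)

(* Defs.v *)
From HB Require Import structures.
From mathcomp Require Import all_boot all_order all_algebra.
From mathcomp Require Import generic_quotient ring_quotient ring.
From mathcomp Require Import freeg mpoly.
From mathcomp Require Import complex boolp reals.

Set Implicit Arguments.
Unset Strict Implicit.
Unset Printing Implicit Defensive.

Import GRing.Theory.

Local Open Scope ring_scope.
Local Open Scope quotient_scope.

HB.mixin Record Lmodule_isLieAlgebra (K : fieldType) L of GRing.Lmodule K L := {
  lieb : L -> L -> L;
  lieb_linearl : forall z, linear (lieb^~ z);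
  lieb_linearr : forall x, linear (lieb x);
  liebxx : forall x, lieb x x = 0;
  lieb_jacobi : forall x y z,
    lieb x (lieb y z) + lieb y (lieb z x) + lieb z (lieb x y) = 0
}.

#[short(type="lieAlgType")]
HB.structure Definition LieAlgebra (K : fieldType) :=
  {L of Lmodule_isLieAlgebra K L & GRing.Lmodule K L}.

HB.mixin Record Lmodule_isLieModule (K : fieldType) (L : lieAlgType K) M
    of GRing.Lmodule K M := {
  lact : L -> M -> M;
  lact_linearl : forall v, linear (lact^~ v);
  lact_linearr : forall x, linear (lact x);
  lact_lieb : forall x y v,
    lact (lieb x y) v = lact x (lact y v) - lact y (lact x v)
}.

#[short(type="lieModType")]
HB.structure Definition LieModule (K : fieldType) (L : lieAlgType K) :=
  {M of Lmodule_isLieModule K L M & GRing.Lmodule K M}.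

HB.mixin Record isLieActionClosed (K : fieldType) (L : lieAlgType K)
    (M : lieModType L) (N : M -> bool) := {
  lact_closed : forall (x : L) v, v \in N -> lact x v \in N
}.

(* Submodules are boolean predicates, as for [submodClosed]; with [asbool] every
   subspace is of this form. *)
#[short(type="lieSubmodClosed")]
HB.structure Definition LieSubmodClosed (K : fieldType) (L : lieAlgType K)
    (M : lieModType L) :=
  {N of GRing.SubmodClosed K N & isLieActionClosed K L M N}.

Definition irreducible_submod (K : fieldType) (L : lieAlgType K)
    (M : lieModType L) (N : lieSubmodClosed M) : Prop :=
  (exists2 v, v \in N & v != 0) /\
  (forall N' : lieSubmodClosed M, {subset N' <= N} ->
     N' =i pred1 (0 : M) \/ N' =i N).

Section LieBilinear.
Variables (K : fieldType) (L : lieAlgType K) (M : lieModType L).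

HB.instance Definition _ (x : L) :=
  GRing.isLinear.Build K L L _ (lieb x) (lieb_linearr x).
HB.instance Definition _ (x : L) :=
  GRing.isLinear.Build K M M _ (lact x) (lact_linearr x).

Lemma liebDZl a (x y z : L) : lieb (a *: x + y) z = a *: lieb x z + lieb y z.
Proof. exact: (lieb_linearl z). Qed.

Lemma lactDZl a (x y : L) (v : M) : lact (a *: x + y) v = a *: lact x v + lact y v.
Proof. exact: (lact_linearl v). Qed.

End LieBilinear.

(* The zmodule [Quotient.quot] of ring_quotient, with its scalar and Lie
   actions. *)
Section QuotientModule.
Variables (K : fieldType) (L : lieAlgType K) (M : lieModType L).
Variable N : lieSubmodClosed M.

Lemma lie_submod_zmod_closed : zmod_closed (N : {pred M}).
Proof.
by split=> [|v w Nv Nw]; rewrite ?rpred0 // rpredD // -scaleN1r rpredZ.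
Qed.

Definition zmod_of_submod : zmodClosed M :=
  HB.pack (N : {pred M}) (GRing.isZmodClosed.Build M (N : {pred M}) lie_submod_zmod_closed).

Definition quot_mod := Quotient.quot zmod_of_submod.

HB.instance Definition _ := Choice.on quot_mod.
HB.instance Definition _ := GRing.Zmodule.on quot_mod.

Definition qpi (v : M) : quot_mod := \pi_(Quotient.quot zmod_of_submod) v.
Definition qrepr (q : quot_mod) : M := repr (q : Quotient.quot zmod_of_submod).

Lemma qreprK : cancel qrepr qpi. Proof. exact: reprK. Qed.

Lemma qpi_eq v w : (qpi v == qpi w) = (v - w \in N).
Proof. exact: (esym (@Quotient.idealrBE M zmod_of_submod v w)). Qed.

Lemma qpiP v w : v - w \in N -> qpi v = qpi w.
Proof. by move=> h; apply/eqP; rewrite qpi_eq. Qed.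

Lemma qpi_zmod : zmod_morphism qpi.
Proof. by move=> v w; rewrite /qpi raddfB. Qed.

HB.instance Definition _ := GRing.isZmodMorphism.Build M quot_mod qpi qpi_zmod.

Definition qscale (a : K) (q : quot_mod) : quot_mod := qpi (a *: qrepr q).
Definition qact (x : L) (q : quot_mod) : quot_mod := qpi (lact x (qrepr q)).

Lemma qreprB v : qrepr (qpi v) - v \in N.
Proof. by rewrite -qpi_eq qreprK. Qed.

Lemma qpi_scale a v : qpi (a *: v) = qscale a (qpi v).
Proof. by apply/esym/qpiP; rewrite -scalerBr rpredZ // qreprB. Qed.

Lemma qpi_act x v : qpi (lact x v) = qact x (qpi v).
Proof. by apply/esym/qpiP; rewrite -raddfB lact_closed // qreprB. Qed.

Lemma qscaleA a b q : qscale a (qscale b q) = qscale (a * b) q.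
Proof. by rewrite -(qreprK q) -!qpi_scale scalerA. Qed.
Lemma qscale1 : left_id 1 qscale.
Proof. by move=> q; rewrite -(qreprK q) -!qpi_scale scale1r. Qed.
Lemma qscaleDr : right_distributive qscale +%R.
Proof.
move=> a q r; rewrite -(qreprK q) -(qreprK r) -raddfD -!qpi_scale.
by rewrite scalerDr raddfD.
Qed.
Lemma qscaleDl q : {morph qscale^~ q : a b / a + b}.
Proof. by move=> a b; rewrite -(qreprK q) -!qpi_scale scalerDl raddfD. Qed.

HB.instance Definition _ :=
  GRing.Zmodule_isLmodule.Build K quot_mod qscaleA qscale1 qscaleDr qscaleDl.

Lemma qpi_scalable : scalable qpi. Proof. exact: qpi_scale. Qed.

HB.instance Definition _ := GRing.isScalable.Build K M quot_mod _ qpi qpi_scalable.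

Lemma qact_linearl q : linear (qact^~ q).
Proof.
by move=> a x y; rewrite -(qreprK q) -!qpi_act lactDZl linearP.
Qed.

Lemma qact_linearr x : linear (qact x).
Proof.
move=> a q r; rewrite -(qreprK q) -(qreprK r) -linearP -!qpi_act.
by rewrite !linearP.
Qed.

Lemma qact_lieb x y q :
  qact (lieb x y) q = qact x (qact y q) - qact y (qact x q).
Proof. by rewrite -(qreprK q) -!qpi_act lact_lieb raddfB. Qed.

HB.instance Definition _ := Lmodule_isLieModule.Build K L quot_mod
  qact_linearl qact_linearr qact_lieb.

End QuotientModule.

Section FreegLinear.
Variables (K : fieldType) (B : choiceType) (V : lmodType K) (f : B -> V).

Lemma freeg_ind (P : {freeg B / K} -> Prop) :
  P 0 -> (forall a b x, P x -> P (a *: << b >> + x)) -> forall x, P x.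
Proof.
move=> P0 Ps; elim/freeg_ind_dom0 => // a b x _ _ Px.
have -> : << a *g b >> = a *: << b >> :> {freeg B / K}.
  by apply/eqP/freeg_eqP => c; rewrite coeffZ !coeffU mul1r.
exact: Ps.
Qed.

Lemma fglift1 b : fglift f << b >> = f b.
Proof. by rewrite liftU scale1r. Qed.

Lemma fglift_linear : linear (fglift f).
Proof.
have fB : zmod_morphism (fglift f) := lift_is_additive f.
pose fa : {additive _ -> _} :=
  HB.pack (fglift f) (GRing.isZmodMorphism.Build _ _ (fglift f) fB).
have fD x y : fglift f (x + y) = fglift f x + fglift f y by exact: (raddfD fa).
have f0 : fglift f 0 = 0 by exact: (raddf0 fa).
have E c k : c *: << k >> = << c *g k >> :> {freeg B / K}.
  by apply/eqP/freeg_eqP => c'; rewrite coeffZ !coeffU mul1r.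
move=> a x y; rewrite fD; congr (_ + _).
elim/freeg_ind: x => [|b k x IH]; first by rewrite scaler0 f0 scaler0.
by rewrite scalerDr !fD scalerDr IH scalerA !E !liftU scalerA.
Qed.

HB.instance Definition _ :=
  GRing.isLinear.Build K {freeg B / K} V _ (fglift f) fglift_linear.

End FreegLinear.

Notation ZZ2 := {ffun 'I_2 -> int}.

(* The free K-module on the symbols [(r, i)], standing for t^r ∂_i. *)
Definition witt (K : fieldType) : Type := {freeg (ZZ2 * 'I_2)%type / K}.

HB.instance Definition _ (K : fieldType) := GRing.Lmodule.on (witt K).

Section Witt.
Variable K : fieldType.
Implicit Types (r s : ZZ2) (i j : 'I_2) (x y z : witt K).

Definition der r i : witt K := << (r, i) >>.

Definition witt_lieb1 (p q : ZZ2 * 'I_2) : witt K :=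
  let: (r, i) := p in let: (s, j) := q in
  (s i)%:~R *: der (r + s) j - (r j)%:~R *: der (r + s) i.

(* The bilinear extension of [t^r ∂_i, t^s ∂_j] = s_i t^(r+s) ∂_j - r_j t^(r+s) ∂_i. *)
Definition witt_lieb x y : witt K :=
  fglift (fun p => fglift (witt_lieb1 p) y) x.

Lemma witt_lieb_linearl y : linear (witt_lieb^~ y).
Proof. exact: fglift_linear. Qed.

Lemma witt_lieb_linearr x : linear (witt_lieb x).
Proof.
move=> a y z; elim/freeg_ind: x => [|b p x IH].
  by rewrite /witt_lieb !linear0 addr0.
rewrite !witt_lieb_linearl {}IH /witt_lieb !fglift1 linearP.
by rewrite !scalerDr !scalerA [b * a]mulrC addrACA.
Qed.

Lemma witt_liebE r i s j :
  witt_lieb (der r i) (der s j) =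
  (s i)%:~R *: der (r + s) j - (r j)%:~R *: der (r + s) i.
Proof. by rewrite /witt_lieb !fglift1. Qed.

Lemma witt_lieb0l y : witt_lieb 0 y = 0.
Proof. by rewrite /witt_lieb linear0. Qed.

Lemma witt_lieb0r x : witt_lieb x 0 = 0.
Proof.
have := witt_lieb_linearr x 1 0 0; rewrite scaler0 addr0 scale1r => /eqP.
by rewrite -{1}[witt_lieb x 0]addr0 (inj_eq (addrI _)) eq_sym => /eqP.
Qed.

Lemma witt_liebC x y : witt_lieb x y = - witt_lieb y x.
Proof.
elim/freeg_ind: x => [|a [r i] x IHx]; first by rewrite witt_lieb0l witt_lieb0r oppr0.
rewrite witt_lieb_linearl witt_lieb_linearr {}IHx opprD; congr (_ + _).
rewrite -scalerN; congr (_ *: _).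
elim/freeg_ind: y => [|b [s j] y IHy]; first by rewrite witt_lieb0l witt_lieb0r oppr0.
rewrite witt_lieb_linearl witt_lieb_linearr {}IHy opprD -scalerN.
by rewrite !witt_liebE opprB [s + r]addrC.
Qed.

Lemma witt_liebxx x : witt_lieb x x = 0.
Proof.
elim/freeg_ind: x => [|a [r i] x IH]; first exact: witt_lieb0l.
rewrite witt_lieb_linearl !witt_lieb_linearr IH witt_liebE subrr scaler0 add0r.
by rewrite addr0 [witt_lieb x _]witt_liebC scalerN subrr.
Qed.

Lemma witt_jacobi x y z :
  witt_lieb x (witt_lieb y z) + witt_lieb y (witt_lieb z x)
  + witt_lieb z (witt_lieb x y) = 0.
Proof.
have lZr u a v w : witt_lieb u (a *: v + w) = a *: witt_lieb u v + witt_lieb u w.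
  exact: witt_lieb_linearr.
have lZl u a v w : witt_lieb (a *: v + w) u = a *: witt_lieb v u + witt_lieb w u.
  exact: witt_lieb_linearl.
have lr u a v b w :
  witt_lieb u (a *: v - b *: w) = a *: witt_lieb u v - b *: witt_lieb u w.
  by rewrite lZr -scaleNr -[X in _ + witt_lieb u X]addr0 lZr witt_lieb0r addr0 scaleNr.
have comb a (A A' B B' C C' : witt K) :
    A + B + C = 0 -> A' + B' + C' = 0 ->
    (a *: A + A') + (a *: B + B') + (a *: C + C') = 0.
  move=> h h'; rewrite [X in X + _ = _]addrACA [LHS]addrACA -!scalerDr h h'.
  by rewrite scaler0 addr0.
elim/freeg_ind: x => [|a [r i] x IHx].
  by rewrite !(witt_lieb0l, witt_lieb0r, addr0).
rewrite !(lZl, lZr); apply: (comb _ _ _ _ _ _ _ _ IHx) => {IHx}.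
elim/freeg_ind: y => [|b [s j] y IHy].
  by rewrite !(witt_lieb0l, witt_lieb0r, addr0).
rewrite !(lZl, lZr); apply: (comb _ _ _ _ _ _ _ _ IHy) => {IHy}.
elim/freeg_ind: z => [|c [t k] z IHz].
  by rewrite !(witt_lieb0l, witt_lieb0r, addr0).
rewrite !(lZl, lZr); apply: (comb _ _ _ _ _ _ _ _ IHz) => {IHz}.
rewrite !(witt_liebE, lr) !ffunE.
have -> : s + (t + r) = r + (s + t) by rewrite addrA addrC.
have -> : t + (r + s) = r + (s + t) by rewrite addrCA [t + s]addrC.
apply/eqP/freeg_eqP => q.
rewrite !(coeffD, coeffN, coeffZ) coeff0 !intrD.
ring.
Qed.

End Witt.

Arguments der {K} r i.

Lemma witt_ind (K : fieldType) (P : witt K -> Prop) :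
  P 0 -> (forall a r i x, P x -> P (a *: der r i + x)) -> forall x, P x.
Proof. by move=> P0 Ps; apply: freeg_ind => // a [r i]; apply: Ps. Qed.

HB.instance Definition _ (K : fieldType) :=
  Lmodule_isLieAlgebra.Build K (witt K) (@witt_lieb_linearl K)
    (@witt_lieb_linearr K) (@witt_liebxx K) (@witt_jacobi K).

Definition in_span (K : fieldType) (V : lmodType K) (G : V -> Prop) (x : V) : Prop :=
  exists (n : nat) (c : 'I_n -> K) (g : 'I_n -> V),
    (forall k, G (g k)) /\ x = \sum_k c k *: g k.

Section Span.
Variables (K : fieldType) (V : lmodType K) (G : V -> Prop).

Lemma in_span0 : in_span G 0.
Proof.
exists 0, (fun=> 0), (fun=> 0); split; first by case.
by rewrite big_ord0.
Qed.

Lemma in_span_gen g : G g -> in_span G g.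
Proof.
move=> Gg; exists 1, (fun=> 1), (fun=> g); split => //.
by rewrite big_ord1 scale1r.
Qed.

Lemma in_spanD x y : in_span G x -> in_span G y -> in_span G (x + y).
Proof.
move=> [n [c [g [Gg ->]]]] [m [d [h [Gh ->]]]].
exists (n + m)%N, (fun k => match split k with inl i => c i | inr j => d j end).
exists (fun k => match split k with inl i => g i | inr j => h j end); split.
  by move=> k; case: split.
rewrite big_split_ord /=; congr (_ + _); apply: eq_bigr => k _.
  by rewrite (unsplitK (inl k)).
by rewrite (unsplitK (inr k)).
Qed.

Lemma in_spanZ a x : in_span G x -> in_span G (a *: x).
Proof.
move=> [n [c [g [Gg ->]]]]; exists n, (fun k => a * c k), g; split=> //.
by rewrite scaler_sumr; apply: eq_bigr => k _; rewrite scalerA.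
Qed.

Lemma in_span_ind (P : V -> Prop) :
  P 0 -> (forall a g x, G g -> P x -> P (a *: g + x)) ->
  forall x, in_span G x -> P x.
Proof.
move=> P0 Ps x [n [c [g [Gg ->]]]].
by elim/big_rec: _ => // k y _; apply: Ps.
Qed.

End Span.

Section STilde.
Variable K : fieldType.
Implicit Types (r s : ZZ2) (i j : 'I_2).

Definition divfree r : witt K := (r 1)%:~R *: der r 0 - (r 0)%:~R *: der r 1.

Definition stilde_gen (x : witt K) : Prop :=
  (exists i, x = der 0 i) \/ (exists r, x = divfree r).

Definition stilde : {pred witt K} := fun x => `[< in_span stilde_gen x >].

Lemma stilde_submod_closed : submod_closed stilde.
Proof.
split=> [|a x y]; rewrite ?inE; first exact/asboolP/in_span0.
move=> /asboolP hx /asboolP hy; apply/asboolP.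
by apply: in_spanD => //; apply: in_spanZ.
Qed.

HB.instance Definition _ :=
  GRing.isSubmodClosed.Build K (witt K) stilde stilde_submod_closed.

Lemma der0_stilde i : der 0 i \in stilde.
Proof. by apply/asboolP/in_span_gen; left; exists i. Qed.

Lemma divfree_stilde r : divfree r \in stilde.
Proof. by apply/asboolP/in_span_gen; right; exists r. Qed.

Lemma stilde_ind (P : witt K -> Prop) :
  P 0 -> (forall a i x, P x -> P (a *: der 0 i + x)) ->
  (forall a r x, P x -> P (a *: divfree r + x)) ->
  forall x, x \in stilde -> P x.
Proof.
move=> P0 P1 P2 x /asboolP; move: x; apply: in_span_ind => // a g x.
by case=> [[i ->]|[r ->]]; [apply: P1|apply: P2].
Qed.

Lemma lieb_der0 i j : lieb (der 0 i : witt K) (der 0 j) = 0.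
Proof. by rewrite [LHS]witt_liebE !ffunE !scale0r subrr. Qed.

Lemma lieb_der0_divfree i s :
  lieb (der 0 i : witt K) (divfree s) = (s i)%:~R *: divfree s.
Proof.
rewrite /divfree linearB !linearZ /=.
have E j : lieb (der 0 i : witt K) (der s j) = (s i)%:~R *: der s j.
  by rewrite [LHS]witt_liebE add0r ffunE scale0r subr0.
by rewrite !E scalerDr !scalerN !scalerA ![(s i)%:~R * _]mulrC.
Qed.

Lemma lieb_divfree r s :
  lieb (divfree r) (divfree s)
  = (r 1 * s 0 - r 0 * s 1)%:~R *: divfree (r + s).
Proof.
have lieDl a b (x y z : witt K) :
  lieb (a *: x - b *: y) z = a *: lieb x z - b *: lieb y z.
  by rewrite liebDZl -scaleNr -[- b *: y]addr0 liebDZl [lieb 0 z]witt_lieb0l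
    addr0 scaleNr.
have E i j : lieb (der r i : witt K) (der s j) =
    (s i)%:~R *: der (r + s) j - (r j)%:~R *: der (r + s) i.
  exact: witt_liebE.
rewrite /divfree lieDl !linearB !linearZ /= !E !ffunE.
apply/eqP/freeg_eqP => q.
rewrite !(coeffD, coeffN, coeffZ) !(rmorphD, rmorphN, rmorphM) /=.
ring.
Qed.

Lemma lieb_stilde : {in stilde &, forall x y, lieb x y \in stilde}.
Proof.
move=> x y hx; move: x hx y.
have l0 (y : witt K) : lieb 0 y = 0 by exact: witt_lieb0l.
have lC (x y : witt K) : lieb x y = - lieb y x by exact: witt_liebC.
apply: stilde_ind => [y _|a i x IH y hy|a r x IH y hy].
- by rewrite l0 rpred0.
- rewrite liebDZl rpredD ?IH // rpredZ //.
  move: y hy; apply: stilde_ind => [|b j y IHy|b s y IHy].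
  + by rewrite linear0 rpred0.
  + by rewrite linearP /= lieb_der0 scaler0 add0r.
  + by rewrite linearP /= lieb_der0_divfree rpredD // !rpredZ // divfree_stilde.
- rewrite liebDZl rpredD ?IH // rpredZ //.
  move: y hy; apply: stilde_ind => [|b j y IHy|b s y IHy].
  + by rewrite linear0 rpred0.
  + rewrite linearP /= rpredD // rpredZ // lC lieb_der0_divfree -scaleNr.
    by rewrite rpredZ // divfree_stilde.
  + by rewrite linearP /= lieb_divfree rpredD // !rpredZ // divfree_stilde.
Qed.

Definition stilde2 : Type := {x : witt K | x \in stilde}.

HB.instance Definition _ := [isSub for (@sval _ _ : stilde2 -> witt K)].
HB.instance Definition _ := [Choice of stilde2 by <:].
HB.instance Definition _ := [SubChoice_isSubLmodule of stilde2 by <:].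

End STilde.

Section STildeLie.
Variable K : fieldType.
Implicit Types x y z : stilde2 K.

Definition stilde2_lieb x y : stilde2 K :=
  exist _ (lieb (val x) (val y)) (lieb_stilde (valP x) (valP y)).

Lemma sval_linear : linear (\val : stilde2 K -> witt K).
Proof. exact: linearP. Qed.

Lemma sval_lieb x y : \val (stilde2_lieb x y) = lieb (\val x) (\val y).
Proof. by []. Qed.

Lemma stilde2_lieb_linearl z : linear (stilde2_lieb^~ z).
Proof. by move=> a x y; apply: val_inj; rewrite !(sval_linear, sval_lieb) liebDZl. Qed.

Lemma stilde2_lieb_linearr x : linear (stilde2_lieb x).
Proof. by move=> a y z; apply: val_inj; rewrite !(sval_linear, sval_lieb) linearP. Qed.

Lemma stilde2_liebxx x : stilde2_lieb x x = 0.
Proof. by apply: val_inj; rewrite sval_lieb liebxx raddf0. Qed.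

Lemma stilde2_jacobi x y z :
  stilde2_lieb x (stilde2_lieb y z) + stilde2_lieb y (stilde2_lieb z x)
  + stilde2_lieb z (stilde2_lieb x y) = 0.
Proof. by apply: val_inj; rewrite !(raddfD, sval_lieb) /= lieb_jacobi. Qed.

HB.instance Definition _ := Lmodule_isLieAlgebra.Build K (stilde2 K)
  stilde2_lieb_linearl stilde2_lieb_linearr stilde2_liebxx stilde2_jacobi.

Definition sder (i : 'I_2) : stilde2 K := exist _ (der 0 i) (der0_stilde K i).
Definition sdivfree (r : ZZ2) : stilde2 K :=
  exist _ (divfree K r) (divfree_stilde K r).

End STildeLie.

Section Omega.
Variables (K : fieldType) (lam alpha : 'I_2 -> K).
Implicit Types (r s : ZZ2) (i j : 'I_2) (f g : {mpoly K[2]}).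

Definition lampow r : K := \prod_i lam i ^ r i.

(* f(h_1 - r_1, h_2 - r_2) *)
Definition hshift r f : {mpoly K[2]} :=
  f \mPo [tuple 'X_i - ((r i)%:~R)%:MP | i < 2].

Definition hplus i : {mpoly K[2]} := 'X_i + (alpha i)%:MP.

(* A linear map on all of W_2, used only on ~S_2: the lemmas [omega_act_der0]
   and [omega_act_divfree] below give its values on the spanning set. *)
Definition omega_act1 (f : {mpoly K[2]}) (p : ZZ2 * 'I_2) : {mpoly K[2]} :=
  let: (r, i) := p in
  if r == 0 then 'X_i * f else lampow r *: (hplus i * hshift r f).

Definition omega_act (x : witt K) f : {mpoly K[2]} := fglift (omega_act1 f) x.

Lemma omega_actDl a x y f :
  omega_act (a *: x + y) f = a *: omega_act x f + omega_act y f.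
Proof. exact: (fglift_linear (omega_act1 f)). Qed.

Lemma omega_act0l f : omega_act 0 f = 0.
Proof. exact: (raddf0 (fglift (omega_act1 f))). Qed.

Lemma omega_act_der r i f : omega_act (der r i) f = omega_act1 f (r, i).
Proof. exact: fglift1. Qed.

Lemma hshiftDZ r a f g : hshift r (a *: f + g) = a *: hshift r f + hshift r g.
Proof. exact: linearP. Qed.

Lemma omega_act1DZ p a f g :
  omega_act1 (a *: f + g) p = a *: omega_act1 f p + omega_act1 g p.
Proof.
case: p => r i; rewrite /omega_act1.
case: (r == 0); first by rewrite mulrDr -scalerAr.
by rewrite hshiftDZ mulrDr scalerDr -scalerAr !scalerA [a * _]mulrC.
Qed.

Lemma omega_actDr x a f g :
  omega_act x (a *: f + g) = a *: omega_act x f + omega_act x g.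
Proof.
elim/witt_ind: x => [|b r i x IH]; first by rewrite !omega_act0l scaler0 addr0.
rewrite !omega_actDl {}IH !omega_act_der omega_act1DZ.
by rewrite !scalerDr !scalerA [b * a]mulrC addrACA.
Qed.

Lemma omega_act_der0 i f : omega_act (der 0 i) f = 'X_i * f.
Proof. by rewrite omega_act_der /= eqxx. Qed.

Lemma omega_act_divfree r f :
  omega_act (divfree K r) f =
  lampow r *: (((r 1)%:~R *: hplus 0 - (r 0)%:~R *: hplus 1) * hshift r f).
Proof.
have E a b x y : omega_act (a *: x - b *: y) f
    = a *: omega_act x f - b *: omega_act y f.
  rewrite omega_actDl -[- (b *: y)]addr0 -scaleNr omega_actDl omega_act0l.
  by rewrite addr0 scaleNr.
rewrite /divfree E !omega_act_der /omega_act1.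
have [->|_] := eqVneq r 0; first by rewrite !ffunE !scale0r subrr mul0r scaler0.
by rewrite mulrBl -!scalerAl scalerBr !scalerA ![lampow r * _]mulrC.
Qed.

Hypothesis lam_neq0 : forall i, lam i != 0.

Lemma lampowD r s : lampow (r + s) = lampow r * lampow s.
Proof.
rewrite /lampow -big_split /=; apply: eq_bigr => i _.
by rewrite ffunE expfzDr.
Qed.

Lemma hshiftD r s f : hshift r (hshift s f) = hshift (r + s) f.
Proof.
have E t h : hshift t h = \sum_(m <- msupp h) h@_m *: hshift t 'X_[m].
  exact: comp_mpolyEX.
rewrite (E s) (E (r + s)) [LHS]/hshift raddf_sum /=; apply: eq_bigr => m _.
rewrite /hshift !comp_mpolyZ !comp_mpolyX rmorph_prod /=; congr (_ *: _).
apply: eq_bigr => i _; rewrite rmorphXn /= !tnth_mktuple; congr (_ ^+ _).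
rewrite comp_mpolyB comp_mpolyC comp_mpolyXU -tnth_nth tnth_mktuple ffunE.
by rewrite intrD mpolyCD opprD addrA.
Qed.

Lemma hshiftM r f g : hshift r (f * g) = hshift r f * hshift r g.
Proof. exact: rmorphM. Qed.

Lemma hshiftX r i : hshift r 'X_i = 'X_i - ((r i)%:~R)%:MP.
Proof. by rewrite /hshift comp_mpolyXU -tnth_nth tnth_mktuple. Qed.

Lemma hshiftC r (c : K) : hshift r c%:MP = c%:MP.
Proof. exact: comp_mpolyC. Qed.

Lemma hshift_hplus r i : hshift r (hplus i) = hplus i - ((r i)%:~R)%:MP.
Proof.
have -> : hshift r (hplus i) = hshift r 'X_i + hshift r (alpha i)%:MP.
  exact: rmorphD.
by rewrite hshiftX hshiftC addrAC.
Qed.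

Lemma omega_act_lieb_der0_divfree i s f :
  omega_act (lieb (der 0 i) (divfree K s)) f =
  omega_act (der 0 i) (omega_act (divfree K s) f)
  - omega_act (divfree K s) (omega_act (der 0 i) f).
Proof.
have E a x : omega_act (a *: x) f = a *: omega_act x f.
  by rewrite -[a *: x]addr0 omega_actDl omega_act0l addr0.
rewrite lieb_der0_divfree E !omega_act_der0 !omega_act_divfree.
rewrite hshiftM hshiftX -!mul_mpolyC.
set c := _%:MP; set l := _%:MP; set p := _ - _; set q := hshift s f.
set X := mpolyX _ _.
ring.
Qed.

Lemma omega_act_lieb_divfree r s f :
  omega_act (lieb (divfree K r) (divfree K s)) f =
  omega_act (divfree K r) (omega_act (divfree K s) f)
  - omega_act (divfree K s) (omega_act (divfree K r) f).
Proof.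
have E a x : omega_act (a *: x) f = a *: omega_act x f.
  by rewrite -[a *: x]addr0 omega_actDl omega_act0l addr0.
have hZ t a g : hshift t (a *: g) = a *: hshift t g by exact: linearZ.
have hB t g h : hshift t (g - h) = hshift t g - hshift t h by exact: rmorphB.
rewrite lieb_divfree E !omega_act_divfree !(hZ, hshiftM, hB, hshift_hplus).
rewrite !hshiftD [s + r]addrC lampowD !ffunE -!mul_mpolyC.
rewrite !(rmorphB, rmorphM, rmorphD) /=.
set q := hshift _ f; set h0 := hplus 0; set h1 := hplus 1.
set lr := (lampow r)%:MP; set ls := (lampow s)%:MP.
set r0 := ((r 0)%:~R)%:MP; set r1 := ((r 1)%:~R)%:MP.
set s0 := ((s 0)%:~R)%:MP; set s1 := ((s 1)%:~R)%:MP.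
ring.
Qed.

Lemma omega_act_lieb : {in @stilde K &, forall x y, forall f,
  omega_act (lieb x y) f = omega_act x (omega_act y f) - omega_act y (omega_act x f)}.
Proof.
have actN x f : omega_act (- x) f = - omega_act x f.
  by rewrite -scaleN1r -[_ *: x]addr0 omega_actDl omega_act0l addr0 scaleN1r.
have act0r x : omega_act x 0 = 0.
  by have := omega_actDr x (-1) 0 0; rewrite scaler0 addr0 scaleN1r addNr.
have l0 (y : witt K) : lieb 0 y = 0 by exact: witt_lieb0l.
have lC (x y : witt K) : lieb x y = - lieb y x by exact: witt_liebC.
pose Q (x y : witt K) := forall f, omega_act (lieb x y) f =
  omega_act x (omega_act y f) - omega_act y (omega_act x f).
have QC x y : Q x y -> Q y x by move=> h f; rewrite lC actN h opprB.
have Q0 y : Q 0 y by move=> f; rewrite l0 !omega_act0l act0r subrr.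
have QD a x x' y : Q x y -> Q x' y -> Q (a *: x + x') y.
  move=> h h' f; rewrite liebDZl !omega_actDl h h' omega_actDr.
  by rewrite opprD addrACA -scalerBr.
have QDr a x x' y : Q y x -> Q y x' -> Q y (a *: x + x').
  by move=> h h'; apply: (QC); apply: (QD); apply: (QC).
have Q0r y : Q y 0 by apply: (QC).
have Qdf i s : Q (der 0 i) (divfree K s) by exact: omega_act_lieb_der0_divfree.
move=> x y hx; move: x hx y; apply: stilde_ind => [|a i x IH|a r x IH] y hy.
- exact: Q0.
- apply: QD (IH y hy); move: y hy; apply: stilde_ind => [|b j y IHy|b s y IHy].
  + exact: Q0r.
  + apply: (QDr _ _ _ _ _ IHy) => f.
    by rewrite lieb_der0 omega_act0l !omega_act_der0 mulrCA subrr.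
  + exact: QDr.
- apply: QD (IH y hy); move: y hy; apply: stilde_ind => [|b j y IHy|b s y IHy].
  + exact: Q0r.
  + by apply: (QDr _ _ _ _ _ IHy); apply: (QC).
  + by apply: (QDr _ _ _ _ _ IHy) => f; apply: omega_act_lieb_divfree.
Qed.

End Omega.

(* Invertibility of [lam 0] and [lam 1] is what makes the action a Lie
   action, hence the proof argument. *)
Definition omega (K : fieldType) (lam alpha : 'I_2 -> K)
  of (forall i, lam i != 0) : Type := {mpoly K[2]}.

Section OmegaModule.
Variables (K : fieldType) (lam alpha : 'I_2 -> K) (lam_neq0 : forall i, lam i != 0).

Local Notation Om := (omega alpha lam_neq0).

HB.instance Definition _ := GRing.Lmodule.on Om.

Definition omega_lact (x : stilde2 K) (f : Om) : Om := omega_act lam alpha (\val x) f.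

Lemma omega_lact_linearl f : linear (omega_lact^~ f).
Proof. by move=> a x y; rewrite /omega_lact sval_linear omega_actDl. Qed.

Lemma omega_lact_linearr x : linear (omega_lact x).
Proof. by move=> a f g; rewrite /omega_lact omega_actDr. Qed.

Lemma omega_lact_lieb x y f :
  omega_lact (lieb x y) f = omega_lact x (omega_lact y f) - omega_lact y (omega_lact x f).
Proof. exact: (omega_act_lieb alpha lam_neq0 (valP x) (valP y)). Qed.

HB.instance Definition _ := Lmodule_isLieModule.Build K (stilde2 K) Om
  omega_lact_linearl omega_lact_linearr omega_lact_lieb.

Lemma lact_sder i (f : Om) : lact (sder K i) f = 'X_i * f :> {mpoly K[2]}.
Proof. exact: omega_act_der0. Qed.

Lemma lact_sdivfree r (f : Om) : lact (sdivfree K r) f =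
  lampow lam r *: (((r 1)%:~R *: hplus alpha 0 - (r 0)%:~R *: hplus alpha 1)
                   * hshift r f) :> {mpoly K[2]}.
Proof. exact: omega_act_divfree. Qed.

Definition omega' : {pred Om} := fun f : {mpoly K[2]} =>
  `[< exists p q : {mpoly K[2]}, f = p * hplus alpha 0 + q * hplus alpha 1 >].

Lemma omega'_submod_closed : submod_closed omega'.
Proof.
split=> [|a f g].
  by apply/asboolP; exists 0, 0; rewrite !mul0r addr0.
move=> /asboolP[p [q ->]] /asboolP[p' [q' ->]]; apply/asboolP.
exists (a *: p + p'), (a *: q + q').
by rewrite !mulrDl scalerDr !scalerAl addrACA.
Qed.

HB.instance Definition _ :=
  GRing.isSubmodClosed.Build K Om omega' omega'_submod_closed.

Lemma omega'M (g f : {mpoly K[2]}) : f \in omega' -> g * f \in omega'.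
Proof.
move=> /asboolP[p [q ->]]; apply/asboolP; exists (g * p), (g * q).
by rewrite mulrDr !mulrA.
Qed.

Lemma omega'_lact_closed (x : stilde2 K) (f : Om) :
  f \in omega' -> lact x f \in omega'.
Proof.
rewrite /lact /= /omega_lact; case: x => x /= hx hf; move: x hx.
apply: stilde_ind => [|a i x IH|a r x IH].
- by rewrite omega_act0l rpred0.
- by rewrite omega_actDl rpredD ?rpredZ // omega_act_der0 omega'M.
- rewrite omega_actDl rpredD ?rpredZ // omega_act_divfree rpredZ //.
  apply/asboolP; exists ((r 1)%:~R *: hshift r f), (- ((r 0)%:~R *: hshift r f)).
  by rewrite mulrBl mulNr -!scalerAl ![hplus _ _ * _]mulrC.
Qed.

HB.instance Definition _ :=
  isLieActionClosed.Build K (stilde2 K) Om omega' omega'_lact_closed.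

End OmegaModule.

Arguments omega' {K lam} alpha lam_neq0 f.

(* Main.v *)
Require Import Defs.
From HB Require Import structures.
From mathcomp Require Import all_boot all_order all_algebra.
From mathcomp Require Import complex reals.
From mathcomp Require Import ring mpoly boolp.

(* A submodule N is an ideal of C[h_1,h_2], since d_i acts as h_i.  Write
   L_r = r_2 (h_1 + alpha_1) - r_1 (h_2 + alpha_2).  Acting by the elements
   of index k r, k >= 1, and dividing by k, one gets L_r f(h - k r) in N for all
   f in N and all k, hence L_r D^j f in N for all j, where D f = f - f(h - r) is
   locally nilpotent.  The last nonzero D^j f is invariant under translation by
   r, and so is its product with L_r.  Doing this for r = (1,0), starting with
   any f != 0 in N, and then for r = (0,1), starting with the product so
   obtained, ends with a nonzero g invariant under Z^2, hence constant, such that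
   L_(0,1) g is in N: thus h_1 + alpha_1 is in N, and h_2 + alpha_2 is so
   by exchanging the two directions.  Every nonzero submodule therefore contains
   Omega', and the quotient is evaluation at (-alpha_1, -alpha_2). *)

Set Implicit Arguments.
Unset Strict Implicit.
Unset Printing Implicit Defensive.

Import GRing.Theory Num.Theory.

Local Open Scope ring_scope.

(** * Polynomial induction and characteristic zero *)

Lemma mpoly_ring_ind (n : nat) (K : comNzRingType) (P : {mpoly K[n]} -> Prop) :
  (forall c, P c%:MP) -> (forall f g, P f -> P g -> P (f + g)) ->
  (forall i f, P f -> P ('X_i * f)) -> forall f, P f.
Proof.
move=> PC PD PX; elim/mpolyind => [|c m f _ _ Pf]; first by rewrite -mpolyC0.
apply: PD Pf; rewrite -mul_mpolyC mpolyXE_id.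
elim/big_rec: _ => [|i g _ Pg]; first by rewrite mulr1.
elim: (m i) => [|k IH]; first by rewrite expr0 mul1r.
by rewrite exprS -mulrA mulrCA; apply: PX.
Qed.

Lemma natr_inj_pchar0 (R : idomainType) :
  [pchar R] =i pred0 -> injective (fun k : nat => k%:R : R).
Proof.
move=> charR0 k l; have charR := iffLR (pcharf0P R) charR0.
wlog le_kl : k l / (k <= l)%N => [H kl|kl].
  by case/orP: (leq_total k l) => /H; [|move=> /(_ (esym kl))]; auto.
apply/eqP; rewrite eqn_leq le_kl -subn_eq0 -charR natrB //.
by rewrite /= kl subrr.
Qed.

Lemma ord2P (i : 'I_2) : i = 0 \/ i = 1.
Proof. by case: i => -[|[|//]] ?; [left|right]; apply: val_inj. Qed.

(** * Translations and difference operators on polynomials *)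

Section Translation.
Variable K : fieldType.
Implicit Types (r s : ZZ2) (f g : {mpoly K[2]}).

Definition hdiff r f := f - hshift r f.

Lemma hshift0 f : hshift 0 f = f.
Proof.
rewrite -[RHS]comp_mpoly_id /hshift; congr (_ \mPo _); apply: eq_mktuple => i.
by rewrite ffunE mpolyC0 subr0.
Qed.

Lemma hshiftB r f g : hshift r (f - g) = hshift r f - hshift r g.
Proof. exact: rmorphB. Qed.

Lemma hshift_hdiff r s f : hshift s (hdiff r f) = hdiff r (hshift s f).
Proof. by rewrite /hdiff hshiftB !hshiftD [s + r]addrC. Qed.

Lemma iter_hdiffD r j f g :
  iter j (hdiff r) (f + g) = iter j (hdiff r) f + iter j (hdiff r) g.
Proof.
elim: j => //= j ->; rewrite /hdiff.
have -> x y : hshift r (x + y) = hshift r x + hshift r y by exact: rmorphD.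
by rewrite opprD addrACA.
Qed.

Lemma iter_hdiffZ r j c f :
  iter j (hdiff r) (c *: f) = c *: iter j (hdiff r) f.
Proof.
elim: j => //= j ->; rewrite /hdiff.
have -> x : hshift r (c *: x) = c *: hshift r x by exact: linearZ.
by rewrite scalerBr.
Qed.

Lemma iter_hdiff0 r j : iter j (hdiff r) (0 : {mpoly K[2]}) = 0.
Proof. by rewrite -(scale0r 0) iter_hdiffZ !scale0r. Qed.

Lemma iter_hdiff_eq0 r i j f :
  (i <= j)%N -> iter i (hdiff r) f = 0 -> iter j (hdiff r) f = 0.
Proof. by move=> /subnK <- fi; rewrite iterD fi iter_hdiff0. Qed.

(** With D = [hdiff r], D(h_i f) = h_i D f + r_i (f - D f), so multiplying by h_i raises the order
    of nilpotency by at most one. *)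
Lemma hdiff_nilpotent r f : exists j, iter j (hdiff r) f = 0.
Proof.
elim/mpoly_ring_ind: f => [c|f g [i fi] [j gj]|i f [j fj]].
- by exists 1; rewrite /= /hdiff hshiftC subrr.
- exists (maxn i j); rewrite iter_hdiffD (iter_hdiff_eq0 _ fi) ?leq_maxl //.
  by rewrite (iter_hdiff_eq0 _ gj) ?leq_maxr // addr0.
exists j.+1; elim: j f fj => [|j IH] f fj.
  by rewrite (fj : f = 0) mulr0 iter_hdiff0.
rewrite iterSr.
have -> : hdiff r ('X_i * f)
    = 'X_i * hdiff r f + (r i)%:~R *: (f - hdiff r f).
  rewrite /hdiff hshiftM hshiftX opprB [f + _]addrC subrK -mul_mpolyC.
  by rewrite mulrBr mulrBl opprB addrA addrAC.
rewrite iter_hdiffD IH -?iterSr // add0r iter_hdiffZ -scaleN1r iter_hdiffD.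
rewrite iter_hdiffZ -iterSr fj (@iter_hdiff_eq0 _ j.+1 j.+2) //.
by rewrite scaler0 addr0 scaler0.
Qed.

Lemma last_iter_hdiff r f : f != 0 ->
  exists2 j, iter j (hdiff r) f != 0
  & hshift r (iter j (hdiff r) f) = iter j (hdiff r) f.
Proof.
move=> f0; have ex0 : exists j, iter j (hdiff r) f == 0.
  by have [j fj] := hdiff_nilpotent r f; exists j; apply/eqP.
case: (ex_minnP ex0) => -[|j] fj jmin; first by rewrite (negPf f0) in fj.
exists j; first by apply/negP => /jmin; rewrite ltnn.
by move: fj; rewrite iterS subr_eq0 eq_sym => /eqP.
Qed.

Lemma iter_hdiff_invariant r s j f :
  hshift s f = f -> hshift s (iter j (hdiff r) f) = iter j (hdiff r) f.
Proof. by move=> sf; elim: j => //= j IH; rewrite hshift_hdiff IH. Qed.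

Hypothesis charK : [pchar K] =i pred0.

Lemma hshiftMn_invariant r k g : hshift r g = g -> hshift (r *+ k) g = g.
Proof.
by move=> rg; elim: k => [|k IH]; rewrite ?hshift0 // mulrS -hshiftD IH.
Qed.

(* [f(h - t r)] is a polynomial in [t] that is constant on the integers, so one
   can also substitute polynomials for [t]. *)
Lemma invariant_comp r g (t : {mpoly K[2]}) : hshift r g = g ->
  g \mPo [tuple 'X_i - (r i)%:~R *: t | i < 2] = g.
Proof.
move=> rg.
have [F FE] : exists F : {poly {mpoly K[2]}}, forall u,
    F.[u] = g \mPo [tuple 'X_i - (r i)%:~R *: u | i < 2].
  elim/mpoly_ring_ind: {rg} g => [c|f g [F FE] [G GE]|i f [F FE]].
  - by exists (c%:MP)%:P => u; rewrite hornerC comp_mpolyC.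
  - by exists (F + G) => u; rewrite hornerD FE GE rmorphD.
  exists ((('X_i)%:P - (((r i)%:~R)%:MP)%:P * 'X) * F) => u.
  rewrite hornerM FE rmorphM /= comp_mpolyXU -tnth_nth tnth_mktuple.
  by rewrite !hornerE mul_mpolyC.
have natr_mpoly k : k%:R = (k%:R)%:MP :> {mpoly K[2]} by rewrite mpolyC_nat.
have Fnat k : F.[k%:R] = g.
  rewrite FE -[RHS](hshiftMn_invariant k rg) /hshift; congr (_ \mPo _).
  apply: eq_mktuple => i; congr (_ - _).
  by rewrite natr_mpoly -mul_mpolyC -mpolyCM ffunMnE rmorphMn /= mulr_natr.
(* The integers below the size of [F - g%:P] are distinct roots in characteristic zero, more than a
   nonzero polynomial of that size can have. *)
have : F - g%:P = 0.
  apply: (@roots_geq_poly_eq0 _ _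
    [seq k%:R | k <- iota 0 (size (F - g%:P))]).
  - apply/allP => _ /mapP[k _ ->].
    by rewrite rootE !hornerE Fnat subrr.
  - rewrite map_inj_uniq ?iota_uniq // => k l.
    rewrite !natr_mpoly => /(congr1 (meval (fun=> 0))); rewrite !mevalC.
    exact: natr_inj_pchar0.
  - by rewrite size_map size_iota.
by move/subr0_eq => FC; rewrite -FE FC hornerC.
Qed.

Definition axis (i : 'I_2) : ZZ2 := [ffun j => (j == i)%:R].

Lemma invariant_const g : (forall i, hshift (axis i) g = g) ->
  exists c, g = c%:MP.
Proof.
(* [T i] takes t = h_i along axis i: it sends h_i to 0 and fixes the other variable. Composing with
   both leaves only a constant. *)
move=> inv; pose T i := [tuple 'X_j - (axis i j)%:~R *: 'X_i | j < 2]
  : 2.-tuple {mpoly K[2]}.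
have TE i : g \mPo T i = g by apply: invariant_comp.
suff [c gc] : exists c, (g \mPo T 0) \mPo T 1 = c%:MP.
  by exists c; rewrite -gc !TE.
elim/mpoly_ring_ind: {inv TE} g => [c|f g [a fa] [b gb]|i f _].
- by exists c; rewrite !comp_mpolyC.
- by exists (a + b); rewrite !rmorphD /= fa gb.
exists 0; rewrite !rmorphM /= comp_mpolyXU -tnth_nth tnth_mktuple.
rewrite rmorphB /= comp_mpolyZ !comp_mpolyXU -!tnth_nth !tnth_mktuple !ffunE.
rewrite mpolyC0.
by case: (ord2P i) => ->; rewrite /= !(scale0r, scale1r, subr0, subrr, mul0r).
Qed.

End Translation.

(** * Nonzero submodules contain Omega' *)

Section Submodules.
Variables (K : fieldType) (lam alpha : 'I_2 -> K) (lam_neq0 : forall i, lam i != 0).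
Hypothesis charK : [pchar K] =i pred0.
Local Notation Om := (omega alpha lam_neq0).
Implicit Types (r s : ZZ2) (f g : {mpoly K[2]}) (N : lieSubmodClosed Om).

Definition hlin r : {mpoly K[2]} :=
  (r 1)%:~R *: hplus alpha 0 - (r 0)%:~R *: hplus alpha 1.

Lemma hlin_axis0 : hlin (axis 0) = - hplus alpha 1.
Proof. by rewrite /hlin !ffunE scale0r scale1r add0r. Qed.

Lemma hlin_axis1 : hlin (axis 1) = hplus alpha 0.
Proof. by rewrite /hlin !ffunE scale0r scale1r subr0. Qed.

Lemma hplus_neq0 i : hplus alpha i != 0.
Proof.
apply/eqP => /(congr1 (fun f => f@_U_(i))); rewrite mcoeffD mcoeffX eqxx.
rewrite mcoeffC mcoeff0 mnm1_eq0 mulr0 addr0.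
by move/eqP; rewrite oner_eq0.
Qed.

Lemma hlin_axis_neq0 i : hlin (axis i) != 0.
Proof.
case: (ord2P i) => ->.
  by rewrite hlin_axis0 oppr_eq0 hplus_neq0.
by rewrite hlin_axis1 hplus_neq0.
Qed.

Lemma hshift_hlin r : hshift r (hlin r) = hlin r.
Proof.
have hZ a g : hshift r (a *: g) = a *: hshift r g by exact: linearZ.
rewrite /hlin hshiftB !hZ !hshift_hplus -!mul_mpolyC.
move: (hplus _ _) (hplus _ _) (_%:MP) (_%:MP) => x y a b; ring.
Qed.

Lemma hlinMn r k : hlin (r *+ k) = k%:R *: hlin r.
Proof.
have E i : ((r *+ k) i)%:~R = k%:R * (r i)%:~R :> K.
  by rewrite ffunMnE rmorphMn /= mulr_natl.
by rewrite /hlin !E -!scalerA -scalerBr.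
Qed.

Lemma lampow_neq0 r : lampow lam r != 0.
Proof. by apply/prodf_neq0 => i _; rewrite expfz_neq0. Qed.

Lemma submod_mul N f g : f \in N -> (g * f : Om) \in N.
Proof.
move=> Nf; elim/mpoly_ring_ind: g => [c|g g' Ng Ng'|i g Ng].
- by rewrite mul_mpolyC; apply: rpredZ.
- by rewrite mulrDl; apply: rpredD.
- by have := lact_closed (sder K i) _ Ng; rewrite lact_sder mulrA.
Qed.

Lemma submod_hshift N r k f : f \in N -> (hlin r * hshift (r *+ k) f : Om) \in N.
Proof.
(* At k = 0 the acting element is zero and gives no information; the ideal property is used
   instead. *)
move=> Nf; case: k => [|k]; first by rewrite hshift0 submod_mul.
have /(rpredZ (lampow lam (r *+ k.+1) * k.+1%:R)^-1) :
  lact (sdivfree K (r *+ k.+1)) (f : Om) \in N by exact: lact_closed.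
rewrite lact_sdivfree -/(hlin _) hlinMn -scalerAl !scalerA -mulrA mulVf ?scale1r //.
by rewrite mulf_neq0 ?lampow_neq0 // (iffLR (pcharf0P K)).
Qed.

Lemma submod_hdiff N r j f :
  f \in N -> (hlin r * iter j (hdiff r) f : Om) \in N.
Proof.
(* The claim is strengthened to all translates by multiples of r, since a translate of D^(j+1) f is
   the difference of two consecutive translates of D^j f. *)
move=> Nf; suff H k : (hlin r * hshift (r *+ k) (iter j (hdiff r) f) : Om) \in N.
  by have := H 0; rewrite hshift0.
elim: j k => [|j IH] k; first exact: submod_hshift.
rewrite iterS {1}/hdiff hshiftB hshiftD -mulrSr mulrBr.
by apply: (lie_submod_zmod_closed N).2; apply: IH.
Qed.

(** The last clause lets a second application, in another direction, keep the invariance already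
    gained. *)
Lemma submod_invariant N r f : f \in N -> f != 0 ->
  exists g, [/\ g != 0, (hlin r * g : Om) \in N, hshift r g = g
              & forall s, hshift s f = f -> hshift s g = g].
Proof.
move=> Nf /(last_iter_hdiff r)[j gn0 rg]; exists (iter j (hdiff r) f).
by split=> // [|s]; [apply: submod_hdiff|apply: iter_hdiff_invariant].
Qed.

Lemma submod_hlin_axis N f i i' : f \in N -> f != 0 -> i' != i ->
  (hlin (axis i) : Om) \in N.
Proof.
move=> Nf f0 ii'.
have [g [g0 Ng i'g _]] := submod_invariant (axis i') Nf f0.
have g1n0 : hlin (axis i') * g != 0 by rewrite mulf_neq0 ?hlin_axis_neq0.
have [g2 [g2n0 Ng2 ig2 sg2]] := submod_invariant (axis i) Ng g1n0.
have [|c g2E] := @invariant_const _ charK g2.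
  (* Both factors of [hlin (axis i') * g] are invariant along i', and [g2] inherits this. *)
  have i'g2 : hshift (axis i') g2 = g2.
    by apply: sg2; rewrite hshiftM hshift_hlin i'g.
  move=> j; have [->//|ji] := eqVneq j i.
  suff -> : j = i' by [].
  move: ji ii'.
  by case: (ord2P j) => ->; case: (ord2P i) => ->; case: (ord2P i') => ->.
move: g2n0 Ng2; rewrite g2E mpolyC_eq0 => c0.
move=> /(submod_mul (c^-1)%:MP).
by rewrite mulrCA -mpolyCM mulVf // mulr1.
Qed.

Lemma omega'_sub_submod N f : f \in N -> f != 0 ->
  {subset omega' alpha lam_neq0 <= N}.
Proof.
move=> Nf f0 _ /asboolP[p [q ->]].
have N0 : (hplus alpha 0 : Om) \in N.
  by rewrite -hlin_axis1; apply: (@submod_hlin_axis _ f 1 0).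
have N1 : (hplus alpha 1 : Om) \in N.
  rewrite -[hplus alpha 1]opprK -hlin_axis0 -mulN1r.
  exact/submod_mul/(@submod_hlin_axis _ f 0 1).
by apply: rpredD; apply: submod_mul.
Qed.

(** * Omega' as the kernel of evaluation at -alpha *)

Lemma hplus_omega' i : (hplus alpha i : Om) \in omega' alpha lam_neq0.
Proof.
apply/asboolP; case: (ord2P i) => ->.
  by exists 1, 0; rewrite mul1r mul0r addr0.
by exists 0, 1; rewrite mul1r mul0r add0r.
Qed.

Lemma meval_hplus i : (hplus alpha i).@[fun j => - alpha j] = 0.
Proof. by rewrite /hplus mevalD mevalXU mevalC addNr. Qed.

Lemma omega'_subC f :
  (f - (f.@[fun j => - alpha j])%:MP : Om) \in omega' alpha lam_neq0.
Proof.
elim/mpoly_ring_ind: f => [c|f g hf hg|i f hf].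
- by rewrite mevalC subrr; apply: rpred0.
- by rewrite mevalD mpolyCD opprD addrACA; apply: rpredD.
rewrite mevalM mevalXU; set c := f.@[_] in hf *.
(* Modulo h_i + alpha_i, multiplication by h_i is multiplication by -alpha_i, which is how
   evaluation acts. *)
have -> : 'X_i * f - (- alpha i * c)%:MP
    = f * hplus alpha i - (alpha i)%:MP * (f - c%:MP).
  rewrite /hplus mpolyCM mpolyCN mulNr opprK mulrBr mulrDr.
  by rewrite opprB [f * 'X_i]mulrC [f * _%:MP]mulrC addrA addrAC addrK.
apply: (lie_submod_zmod_closed (omega' alpha lam_neq0 : lieSubmodClosed Om)).2.
  by apply: omega'M; apply: hplus_omega'.
exact: omega'M.
Qed.

Lemma omega'E f :
  ((f : Om) \in omega' alpha lam_neq0) = (f.@[fun j => - alpha j] == 0).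
Proof.
apply/idP/eqP => [/asboolP[p [q ->]]|fa].
  by rewrite mevalD !mevalM !meval_hplus !mulr0 addr0.
by have := omega'_subC f; rewrite fa mpolyC0 subr0.
Qed.

Lemma omega'_irreducible :
  irreducible_submod (omega' alpha lam_neq0 : lieSubmodClosed Om).
Proof.
split=> [|N NS].
  by exists (hplus alpha 0); [apply: hplus_omega'|apply: hplus_neq0].
have [[f Nf f0]|N0] := pselect (exists2 f : Om, f \in N & f != 0).
  by right=> g; apply/idP/idP; [apply: NS|apply: (omega'_sub_submod Nf f0)].
left=> f; rewrite inE; apply/idP/eqP => [Nf|->]; last exact: rpred0.
by apply/eqP/negPn/negP => f0; apply: N0; exists f.
Qed.

(** N contains Omega', so irreducibility makes Omega' zero or all of N; the nonzero element h_1 +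
    alpha_1 excludes zero. *)
Lemma irreducible_eq_omega' N :
  irreducible_submod N -> N =i omega' alpha lam_neq0.
Proof.
case=> -[f Nf f0] /(_ (omega' alpha lam_neq0 : lieSubmodClosed Om)).
case=> [|O0 g|O g]; last by rewrite -O.
  exact: omega'_sub_submod Nf f0.
have := hplus_omega' 0; rewrite (O0 (hplus alpha 0)) inE.
by rewrite (negPf (hplus_neq0 0)).
Qed.

(** * The one-dimensional quotient *)

Definition quot_eval (q : quot_mod (omega' alpha lam_neq0)) : K^o :=
  (qrepr q : {mpoly K[2]}).@[fun j => - alpha j].

(** The chosen representative differs from f by an element of Omega', which vanishes at -alpha. *)
Lemma quot_evalE f :
  quot_eval (qpi (omega' alpha lam_neq0) f) = f.@[fun j => - alpha j].
Proof.
have := qreprB (omega' alpha lam_neq0 : lieSubmodClosed Om) f.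
by rewrite omega'E mevalB subr_eq0 => /eqP.
Qed.

Lemma quot_eval_linear : linear quot_eval.
Proof.
move=> a q q'; rewrite -(qreprK q) -(qreprK q') -linearP !quot_evalE.
by rewrite mevalD mevalZ.
Qed.

HB.instance Definition _ := GRing.isLinear.Build K
  (quot_mod (omega' alpha lam_neq0)) K^o _ quot_eval quot_eval_linear.

Lemma quot_eval_bij : bijective quot_eval.
Proof.
(* Each class contains exactly one constant, which provides the inverse. *)
exists (fun c => qpi (omega' alpha lam_neq0) c%:MP) => [q|c].
  rewrite -[RHS]qreprK; apply/esym/qpiP; exact: omega'_subC.
by rewrite quot_evalE mevalC.
Qed.

End Submodules.

(* R[i] is the field of complex numbers; index 0 : 'I_2 is the paper's index 1. *)
Theorem theorem2p7 (R : realType) (lam alpha : 'I_2 -> R[i])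
    (lam_neq0 : forall i, lam i != 0) :
  [/\ irreducible_submod (omega' alpha lam_neq0 : lieSubmodClosed _),
      (forall N : lieSubmodClosed (omega alpha lam_neq0),
         irreducible_submod N -> N =i omega' alpha lam_neq0)
    & (exists phi : {linear quot_mod (omega' alpha lam_neq0) -> R[i]^o},
         bijective phi)].
Proof.
have charC : [pchar R[i]] =i pred0 by exact: pchar_num.
split; [exact: omega'_irreducible|exact: irreducible_eq_omega'|].
by exists (@quot_eval _ _ alpha lam_neq0); apply: quot_eval_bij.
Qed.
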